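(* Let $N\ge 1$, $0<\lambda\le\Lambda$, and assume $\beta:=\frac{\Lambda}{\lambda}(N-1)+1>2$. Let $F:\mathbb{R}^N\times\mathrm{Sym}_N\to\mathbb{R}$ be continuous, uniformly elliptic with constants $\lambda,\Lambda$, and satisfy $F(x,0)=0$ for all $x$. Let $q>\frac{\beta}{\beta-2}$ and $1<\gamma\le\frac{\beta}{\beta-1}$. If $u:\mathbb{R}^N\to[0,\infty)$ is a nonnegative viscosity solution of $$F(x,D^2u)\ge u^q+|Du|^\gamma\quad\text{in }\mathbb{R}^N,$$ then $u$ is constant.
   Context: $\mathrm{Sym}_N$ denotes the real symmetric $N\times N$ matrices. For $M\in\mathrm{Sym}_N$ with eigenvalues $e_1,\dots,e_N$, the Pucci extremal operators are $\mathcal{M}^+_{\lambda,\Lambda}(M)=\sup_{\lambda I_N\le A\le\Lambda I_N}(-\mathrm{Tr}(AM))=-\lambda\sum_{e_k>0}e_k-\Lambda\sum_{e_k<0}e_k$ and $\mathcal{M}^-_{\lambda,\Lambda}(M)=\inf_{\lambda I_N\le A\le\Lambda I_N}(-\mathrm{Tr}(AM))=-\Lambda\sum_{e_k>0}e_k-\lambda\sum_{e_k<0}e_k$. $F$ is uniformly elliptic if $\mathcal{M}^-_{\lambda,\Lambda}(M-Q)\le F(x,M)-F(x,Q)\le\mathcal{M}^+_{\lambda,\Lambda}(M-Q)$ for all $x\in\mathbb{R}^N$, $M,Q\in\mathrm{Sym}_N$ (sign convention: $-\Delta$ is such an operator). A viscosity solution of an inequality $G(x,u,Du,D^2u)\ge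 0$ in an open set $\Omega$ (a viscosity supersolution) is a lower semicontinuous function $u$ such that for every $x_0\in\Omega$ and every $\varphi\in C^2$ for which $u-\varphi$ has a local minimum at $x_0$, one has $G(x_0,u(x_0),D\varphi(x_0),D^2\varphi(x_0))\ge0$. *)

(* Defs.v *)
From HB Require Import structures.
From mathcomp Require Import all_boot all_order all_algebra.
From mathcomp Require Import all_classical all_reals all_analysis.
Set Implicit Arguments. Unset Strict Implicit. Unset Printing Implicit Defensive.
Import Order.TTheory GRing.Theory Num.Theory.
Import numFieldNormedType.Exports.
Local Open Scope classical_set_scope.
Local Open Scope ring_scope.

Section Defs.
Variable R : realType.
Variable N : nat.

Definition symmetric (M : 'M[R]_N) : Prop := M^T = M.

(* Euclidean inner product and norm on R^N (the library norm on 'rV is the sup norm) *)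
Definition dotv (v w : 'rV[R]_N) : R := \sum_(i < N) v ord0 i * w ord0 i.
Definition enorm (v : 'rV[R]_N) : R := Num.sqrt (dotv v v).

Definition qform (A : 'M[R]_N) (v : 'rV[R]_N) : R := (v *m A *m v^T) ord0 ord0.

Definition ellset (lam Lam : R) : set 'M[R]_N :=
  [set A | symmetric A /\
     forall v : 'rV[R]_N, lam * dotv v v <= qform A v /\ qform A v <= Lam * dotv v v].

(* Pucci extremal operators, sign convention: -Delta is elliptic *)
Definition pucci_plus (lam Lam : R) (M : 'M[R]_N) : R :=
  sup [set - \tr (A *m M) | A in ellset lam Lam].
Definition pucci_minus (lam Lam : R) (M : 'M[R]_N) : R :=
  inf [set - \tr (A *m M) | A in ellset lam Lam].

(* F : R^N x Sym_N -> R is represented by a function on all matrices whose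
   relevant properties are only required on symmetric matrices *)
Definition uniformly_elliptic (lam Lam : R) (F : 'rV[R]_N -> 'M[R]_N -> R) : Prop :=
  forall (x : 'rV[R]_N) (M Q : 'M[R]_N), symmetric M -> symmetric Q ->
    pucci_minus lam Lam (M - Q) <= F x M - F x Q /\
    F x M - F x Q <= pucci_plus lam Lam (M - Q).

Definition continuous_on_sym (F : 'rV[R]_N -> 'M[R]_N -> R) : Prop :=
  {within [set p : 'rV[R]_N * 'M[R]_N | symmetric p.2],
     continuous (fun p : 'rV[R]_N * 'M[R]_N => F p.1 p.2)}.

Definition evec (i : 'I_N) : 'rV[R]_N := \row_j (i == j)%:R.

Definition pder (i : 'I_N) (f : 'rV[R]_N -> R) : 'rV[R]_N -> R :=
  fun x => derive f x (evec i).

Definition C2 (f : 'rV[R]_N -> R) : Prop :=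
  continuous f /\
  (forall i x, derivable f x (evec i)) /\
  (forall i, continuous (pder i f)) /\
  (forall i j x, derivable (pder i f) x (evec j)) /\
  (forall i j, continuous (pder j (pder i f))).

Definition grad (f : 'rV[R]_N -> R) (x : 'rV[R]_N) : 'rV[R]_N :=
  \row_i pder i f x.
Definition hessian (f : 'rV[R]_N -> R) (x : 'rV[R]_N) : 'M[R]_N :=
  \matrix_(i, j) pder j (pder i f) x.

Definition lower_semicont (u : 'rV[R]_N -> R) : Prop :=
  forall x (e : R), 0 < e -> \forall y \near x, u x - e < u y.

Definition local_min_at (g : 'rV[R]_N -> R) (x0 : 'rV[R]_N) : Prop :=
  \forall y \near x0, g x0 <= g y.

Definition viscosity_supersolution
  (G : 'rV[R]_N -> R -> 'rV[R]_N -> 'M[R]_N -> R) (u : 'rV[R]_N -> R) : Prop :=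
  lower_semicont u /\
  forall (x0 : 'rV[R]_N) (phi : 'rV[R]_N -> R),
    C2 phi -> local_min_at (fun y => u y - phi y) x0 ->
    0 <= G x0 (u x0) (grad phi x0) (hessian phi x0).

End Defs.

(* Main.v *)
Require Import Defs.
From HB Require Import structures.
From mathcomp Require Import all_boot all_order all_algebra.
From mathcomp Require Import all_classical all_reals all_analysis.
From mathcomp Require Import ring lra.
Import Order.TTheory GRing.Theory Num.Theory.
Import numFieldNormedType.Exports.
Local Open Scope classical_set_scope.
Local Open Scope ring_scope.

(** Already [F(x, D^2 u) >= |Du|^gam] and [u >= 0] force [u] to be constant.
    Fix [y], [e > 0] and, by lower semicontinuity, a ball [|x - y|^2 <= t0] on
    which [u > u y - e].  Since [gam <= beta / (beta - 1)], there are radial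
    strict subsolutions [w] around [y] that decrease to [-oo] at a finite radius
    [r1], this radius being as large as we like: with [r = |x - y|] and
    [L = (beta - 2) * log (r1 / r)], take
      [w = C * r^(2 - beta) * (L^(-p) - p * L^(-p - 1))],  [p = 1 / (gam - 1)].
    The minimum of [u - w] over the annulus is not attained inside, so it lies
    on the inner sphere, because [u >= 0] makes [u - w] large near the outer
    one.  Letting [r1] go to infinity, [w] tends to [0] pointwise and
    [u x >= u y - e] for every [x]. *)

(** * Minima of lower semicontinuous functions, and continuity of real functions *)

Lemma compact_lsc_min {R : realType} (T : topologicalType) (K : set T)
    (f : T -> R) :
  compact K -> K !=set0 ->
  (forall x, K x -> forall e, 0 < e -> \forall y \near x, f x - e < f y) ->
  exists2 z, K z & forall x, K x -> f z <= f x.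
Proof.
move=> Kc [x0 Kx0] flsc.
(* The sublevel sets [A x] are nested, so they form a filter base on the compact [K], which has a
   cluster point [z]. If f x < f z, semicontinuity gives a neighbourhood of [z] that misses
   [A x]. *)
pose A x := K `&` [set y | f y <= f x].
have FF : ProperFilter (filter_from K A).
  apply: filter_from_proper; last first.
    by move=> x Kx; exists x; split => //=.
  apply: filter_from_filter; first by exists x0.
  move=> x y Kx Ky; have [xy|/ltW yx] := leP (f x) (f y).
    exists x => // z [Kz /= zx]; split; split => //=; exact: le_trans xy.
  exists y => // z [Kz /= zy]; split; split => //=; exact: le_trans yx.
have [z [Kz zc]] := Kc _ FF (ex_intro2 _ _ x0 Kx0 (@subIsetl _ _ _)).
exists z => // x Kx; rewrite leNgt; apply/negP => fxz.
have e0 : 0 < f z - f x by rewrite subr_gt0.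
have [y [[_ /= yx]]] := zc _ _ (ex_intro2 _ _ x Kx (@subset_refl _ _))
  (flsc z Kz _ e0).
by move=> /= ; rewrite subKr => /lt_le_trans /(_ yx); rewrite ltxx.
Qed.

Section ContinuousFunctions.
Context {R : realType} {T : topologicalType}.
Implicit Types f g : T -> R.

Lemma continuous_funD {f g} : continuous f -> continuous g ->
  continuous (fun x => f x + g x).
Proof. by move=> cf cg x; apply: cvgD; [exact: cf|exact: cg]. Qed.

Lemma continuous_funB {f g} : continuous f -> continuous g ->
  continuous (fun x => f x - g x).
Proof. by move=> cf cg x; apply: cvgB; [exact: cf|exact: cg]. Qed.

Lemma continuous_funM {f g} : continuous f -> continuous g ->
  continuous (fun x => f x * g x).
Proof. by move=> cf cg x; apply: cvgM; [exact: cf|exact: cg]. Qed.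

Lemma continuous_fun_sum n (f : 'I_n -> T -> R) :
  (forall i, continuous (f i)) -> continuous (fun x => \sum_(i < n) f i x).
Proof.
move=> cf x; apply: cvg_big => [|i _]; first exact: add_continuous.
exact: cf.
Qed.

End ContinuousFunctions.

(** * Euclidean distance, and the Pucci operator on Hessians of radial functions *)

Section Euclidean.
Context {R : realType} {N : nat}.
Implicit Types (A : 'M[R]_N) (x y v w : 'rV[R]_N).

Definition sqdist y x : R := dotv (x - y) (x - y).

Lemma dotvv_ge0 v : 0 <= dotv v v.
Proof. by apply: sumr_ge0 => i _; rewrite -expr2 sqr_ge0. Qed.

Lemma dotvZ (k : R) v : dotv (k *: v) (k *: v) = k ^+ 2 * dotv v v.
Proof.
rewrite /dotv mulr_sumr; apply: eq_bigr => i _; rewrite !mxE; ring.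
Qed.

Lemma enormZ (k : R) v : enorm (k *: v) = `|k| * Num.sqrt (dotv v v).
Proof. by rewrite /enorm dotvZ sqrtrM ?sqr_ge0// sqrtr_sqr. Qed.

Lemma dotvE v w : dotv v w = (v *m w^T) ord0 ord0.
Proof. by rewrite mxE; apply: eq_bigr => i _; rewrite mxE. Qed.

Lemma qform_scalar (c : R) v : qform c%:M v = c * dotv v v.
Proof. by rewrite /qform mul_mx_scalar -scalemxAl mxE dotvE. Qed.

Lemma qform_tr A v : qform A v = \tr (A *m (v^T *m v)).
Proof.
by rewrite mulmxA mxtrace_mulC mulmxA trace_mx11.
Qed.

(** The diagonal entries of P A P^T are the values of the form [A] on the rows of [P]. *)
Lemma qform_ge0_tr_ge0 A (P : 'M[R]_N) :
  (forall v, 0 <= qform A v) -> 0 <= \tr (P *m A *m P^T).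
Proof.
move=> A0; rewrite /mxtrace; apply: sumr_ge0 => i _.
suff -> : (P *m A *m P^T) i i = qform A (row i P) by [].
rewrite /qform -row_mul mxE [RHS]mxE; apply: eq_bigr => k _.
by rewrite !mxE.
Qed.

(* With [P = I - v^T v / |v|^2] the projection orthogonal to [v],
   [tr (P A P) >= 0] reads [tr A >= qform A v / |v|^2]. *)
Lemma qform_le_tr A v : (forall w, 0 <= qform A w) ->
  0 < dotv v v -> qform A v <= dotv v v * \tr A.
Proof.
move=> A0 v0; set t := dotv v v in v0 *.
have tE : v *m v^T = t%:M.
  by rewrite [LHS]mx11_scalar -dotvE.
pose Q := v^T *m v.
have QQ : Q *m Q = t *: Q.
  by rewrite /Q mulmxA -(mulmxA _ v) tE mul_mx_scalar -scalemxAl.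
pose P : 'M[R]_N := t%:M - Q.
have PT : P^T = P by rewrite /P linearB /= tr_scalar_mx trmx_mul trmxK.
have PP : P *m P = t *: P.
  rewrite /P mulmxBl !mulmxBr -!scalar_mxM QQ mul_scalar_mx mul_mx_scalar.
  by rewrite scalerBr subrr subr0 scale_scalar_mx.
have := @qform_ge0_tr_ge0 A P A0.
rewrite PT -mulmxA mxtrace_mulC -mulmxA PP -scalemxAr mxtraceZ.
rewrite pmulr_rge0 // /P mulmxBr mul_mx_scalar linearB /= mxtraceZ.
by rewrite -qform_tr subr_ge0.
Qed.

(** For an admissible [A] with Rayleigh quotient s at [v], the competitor equals c tr A - d s |v|^2.
    Applying [qform_le_tr] to the nonnegative form Lam I - A gives tr A <= Lam (N - 1) + s, and c >=
    0 preserves this bound. Only the scalar s is left to vary. *)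
Lemma pucci_plus_radial_le (lam Lam c d B : R) v :
  lam <= Lam -> 0 <= c -> 0 < dotv v v ->
  (forall s, lam <= s -> s <= Lam ->
     Lam * (N%:R - 1) * c + (c - d * dotv v v) * s <= B) ->
  pucci_plus lam Lam (d *: (v^T *m v) - c%:M) <= B.
Proof.
move=> lamLam c0 t0; set t := dotv v v in t0 * => Bge.
apply: ge_sup.
  (* The supremum is over a nonempty set, since lam I is admissible. *)
  exists (- \tr (lam%:M *m (d *: (v^T *m v) - c%:M))); exists lam%:M => //=.
  split; first exact: tr_scalar_mx.
  move=> w; rewrite qform_scalar lexx; split => //.
  by rewrite ler_wpM2r// dotvv_ge0.
move=> _ [A [_ Aell] <-].
have [Av1 Av2] := Aell v.
pose s := qform A v / t.
have qE : qform A v = s * t by rewrite mulfVK// gt_eqF.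
have s1 : lam <= s by rewrite ler_pdivlMr.
have s2 : s <= Lam by rewrite ler_pdivrMr.
have trA : \tr A <= Lam * (N%:R - 1) + s.
  have := @qform_le_tr (Lam%:M - A) v.
  have E w : qform (Lam%:M - A) w = Lam * dotv w w - qform A w.
    by rewrite -qform_scalar /qform mulmxBr mulmxBl mxE [X in _ + X]mxE.
  rewrite E linearB /= mxtrace_scalar -/t => /(_ _ t0).
  have H w : 0 <= qform (Lam%:M - A) w.
    by rewrite E subr_ge0; case: (Aell w).
  move=> /(_ H); rewrite qE (mulrC Lam) (mulrC s) -mulrBr ler_pM2l //.
  rewrite -mulr_natl; lra.
apply: le_trans (Bge s s1 s2).
rewrite mulmxBr mul_mx_scalar -scalemxAr linearB /= !mxtraceZ -qform_tr qE.
have := ler_wpM2l c0 trA; lra.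
Qed.

Lemma symmetric_radial (c d : R) v : Defs.symmetric (d *: (v^T *m v) - c%:M).
Proof.
by rewrite /Defs.symmetric linearB /= linearZ /= trmx_mul trmxK tr_scalar_mx.
Qed.

Lemma elliptic_le_pucci (lam Lam : R) (F : 'rV[R]_N -> 'M[R]_N -> R) x M :
  uniformly_elliptic lam Lam F -> F x 0 = 0 -> Defs.symmetric M ->
  F x M <= pucci_plus lam Lam M.
Proof.
move=> Fell F0 Msym; have S0 : Defs.symmetric (0 : 'M[R]_N) by exact: trmx0.
by have [_] := Fell x M 0 Msym S0; rewrite F0 !subr0.
Qed.

Lemma sqr_coord_le_sqdist y x i : (x ord0 i - y ord0 i) ^+ 2 <= sqdist y x.
Proof.
rewrite /sqdist /dotv (bigD1 i)//= !mxE -expr2.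
by rewrite lerDl sumr_ge0// => j _; rewrite -expr2 sqr_ge0.
Qed.

Lemma sqdist_continuous y : continuous (sqdist y).
Proof.
have -> : sqdist y = fun x =>
    \sum_(i < N) (x ord0 i - y ord0 i) * (x ord0 i - y ord0 i).
  by apply/funext => x; apply: eq_bigr => i _; rewrite !mxE.
apply: continuous_fun_sum => i.
have cX : continuous (fun x => x ord0 i - y ord0 i).
  by apply: continuous_funB; [exact: coord_continuous|exact: cst_continuous].
exact: (continuous_funM cX cX).
Qed.

Lemma sqdist_ball_compact y (r : R) : compact [set x | sqdist y x <= r].
Proof.
have [r0|r0] := ltP r 0.
  rewrite (_ : [set _ | _] = set0); first exact: compact0.
  rewrite -subset0 => x /= /le_lt_trans /(_ r0).
  by rewrite ltNge dotvv_ge0.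
(* Here [r] bounds the squared distance; r <= (r + 1)^2 makes [r + 1] a valid half-side without
   square roots. *)
pose box : set 'rV[R]_N := [set x | forall i,
  `[y ord0 i - (r + 1), y ord0 i + (r + 1)]%classic (x ord0 i)].
have boxc : compact box.
  apply: (@rV_compact R N
    (fun i => `[y ord0 i - (r + 1), y ord0 i + (r + 1)]%classic)) => i.
  exact: segment_compact.
apply: (subclosed_compact _ boxc).
- have /continuous_closedP closedT := @sqdist_continuous y.
  exact: (closedT [set t | t <= r] (@closed_le _ _)).
- move=> x /= xr i; rewrite set_itvE /=.
  have H := le_trans (sqr_coord_le_sqdist y x i) xr.
  apply/andP; split; nra.
Qed.

End Euclidean.

(** * Quadratic polynomials in |x - y|^2 as test functions *)

Section TestFunctions.
Context {R : realType} {N : nat}.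
Implicit Types (x y v : 'rV[R]_N).

Lemma is_derive_coord x v (i : 'I_N) :
  is_derive x v (fun z : 'rV[R]_N => z ord0 i) (v ord0 i).
Proof.
have H : h^-1 *: ((h *: v + x) ord0 i - x ord0 i) @[h --> (0:R)^'] -->
    v ord0 i.
  apply: (@cvg_trans _ (v ord0 i @[h --> (0:R)^'])); last exact: cvg_cst.
  apply: near_eq_cvg; near=> h.
  rewrite !mxE addrK /GRing.scale /= mulKf//.
  by near: h; exact: nbhs_dnbhs_neq.
apply: DeriveDef; first by apply/cvg_ex; exists (v ord0 i).
by apply/cvg_lim.
Unshelve. all: by end_near. Qed.

Lemma is_derive_sqdist y x v :
  is_derive x v (sqdist y) (2 * dotv (x - y) v).
Proof.
have -> : sqdist y = \sum_(i < N)
    ((fun z : 'rV[R]_N => z ord0 i) - cst (y ord0 i)) *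
    ((fun z : 'rV[R]_N => z ord0 i) - cst (y ord0 i)).
  apply/funext => z; rewrite fct_sumE; apply: eq_bigr => i _.
  by rewrite !mxE.
apply: is_derive_eq.
  apply: is_derive_sum => i.
  have H : is_derive x v ((fun z : 'rV[R]_N => z ord0 i) - cst (y ord0 i))
      (v ord0 i - 0).
    by apply: is_deriveB; exact: is_derive_coord.
  exact: is_deriveM.
rewrite /dotv mulr_sumr; apply: eq_bigr => i _.
rewrite !mxE /GRing.scale /= !fctE; ring.
Qed.

(** As a function of t = |x - y|^2, this is the quadratic with value 0, first derivative [a] and
    second derivative [b] at [t0]. Using the squared distance keeps it smooth on the whole space,
    including at [y]. *)
Definition radial_quad y (t0 a b : R) x : R :=
  a * (sqdist y x - t0) + b / 2 * (sqdist y x - t0) ^+ 2.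

Lemma dotv_evec v (i : 'I_N) : dotv v (evec R i) = v ord0 i.
Proof.
rewrite /dotv (bigD1 i)//= mxE eqxx mulr1 big1 ?addr0// => j ji.
by rewrite mxE eq_sym (negbTE ji) mulr0.
Qed.

Variables (y : 'rV[R]_N) (t0 a b : R).
Local Notation phi := (radial_quad y t0 a b).

Lemma is_derive_radial_quad x v : is_derive x v phi
  ((a + b * (sqdist y x - t0)) * (2 * dotv (x - y) v)).
Proof.
have -> : phi = a \*: (sqdist y - cst t0) +
    (b / 2) \*: ((sqdist y - cst t0) ^+ 2) by [].
have H : is_derive x v (sqdist y - cst t0) (2 * dotv (x - y) v - 0).
  by apply: is_deriveB; exact: is_derive_sqdist.
apply: is_derive_eq.
rewrite /GRing.scale /= !fctE; by field.
Qed.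

Lemma pder_radial_quad i : pder i phi =
  fun x => (a + b * (sqdist y x - t0)) * (2 * (x ord0 i - y ord0 i)).
Proof.
apply/funext => x; rewrite /pder.
have H := is_derive_radial_quad x (evec R i).
by rewrite derive_val dotv_evec !mxE.
Qed.

Lemma is_derive_pder_radial_quad i x v : is_derive x v (pder i phi)
  (b * (2 * dotv (x - y) v) * (2 * (x ord0 i - y ord0 i)) +
   (a + b * (sqdist y x - t0)) * (2 * v ord0 i)).
Proof.
rewrite pder_radial_quad.
have -> : (fun x => (a + b * (sqdist y x - t0)) * (2 * (x ord0 i - y ord0 i)))
  = (cst a + b \*: (sqdist y - cst t0)) *
    (cst 2 * ((fun z : 'rV[R]_N => z ord0 i) - cst (y ord0 i))) by [].
have H1 : is_derive x v (sqdist y - cst t0) (2 * dotv (x - y) v - 0).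
  by apply: is_deriveB; exact: is_derive_sqdist.
have H2 : is_derive x v ((fun z : 'rV[R]_N => z ord0 i) - cst (y ord0 i))
      (v ord0 i - 0).
  by apply: is_deriveB; exact: is_derive_coord.
apply: is_derive_eq.
have E : (b \*: (sqdist y - cst t0)) x = b * (sqdist y x - t0) by [].
rewrite !fctE in E *; rewrite E /GRing.scale /=; ring.
Qed.

Lemma pder2_radial_quad i j : pder j (pder i phi) =
  fun x => b * (2 * (x ord0 j - y ord0 j)) * (2 * (x ord0 i - y ord0 i)) +
   (a + b * (sqdist y x - t0)) * (2 * (j == i)%:R).
Proof.
apply/funext => x; rewrite {1}/pder.
have H := is_derive_pder_radial_quad i x (evec R j).
by rewrite derive_val dotv_evec !mxE.
Qed.

Lemma C2_radial_quad : C2 phi.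
Proof.
have ccst (c : R) : continuous (fun _ : 'rV[R]_N => c) by exact: cst_continuous.
have cT : continuous (fun x => sqdist y x - t0).
  exact: continuous_funB (sqdist_continuous y) (ccst _).
have cX i : continuous (fun x : 'rV[R]_N => 2 * (x ord0 i - y ord0 i) : R).
  apply: (continuous_funM (ccst _)); apply: continuous_funB (ccst _).
  exact: coord_continuous.
have cA : continuous (fun x => a + b * (sqdist y x - t0)).
  exact: continuous_funD (ccst _) (continuous_funM (ccst _) cT).
split.
  apply: (continuous_funD (continuous_funM (ccst _) cT)).
  exact: continuous_funM (ccst _) (continuous_funM cT cT).
split; first by move=> i x; have := is_derive_radial_quad x (evec R i); case.
split; first by move=> i; rewrite pder_radial_quad; exact: continuous_funM.
split.
  by move=> i j x; have := is_derive_pder_radial_quad i x (evec R j); case.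
move=> i j; rewrite pder2_radial_quad; apply: continuous_funD.
  exact: continuous_funM (continuous_funM (ccst _) (cX j)) (cX i).
exact: continuous_funM cA (ccst _).
Qed.

Lemma grad_radial_quad x : sqdist y x = t0 -> grad phi x = (2 * a) *: (x - y).
Proof.
move=> xt; apply/rowP => i; rewrite !mxE pder_radial_quad xt; ring.
Qed.

(** The multiple of the identity is written as a subtraction to match [pucci_plus_radial_le] with c
    = -2a, which is nonnegative for radially decreasing functions. *)
Lemma hessian_radial_quad x : sqdist y x = t0 ->
  hessian phi x = (4 * b) *: ((x - y)^T *m (x - y)) - (- (2 * a))%:M.
Proof.
move=> xt; apply/matrixP => i j; rewrite !mxE pder2_radial_quad xt.
rewrite big_ord1 !mxE eq_sym; case: (j == i) => /=; ring.
Qed.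

End TestFunctions.

(** * Comparison of a supersolution with radial strict subsolutions *)

Lemma taylor2_le {R : realType} (f df : R -> R) (t0 d2 e : R) : 0 < e ->
  (\forall t \near t0, is_derive t (1 : R) f (df t)) ->
  is_derive t0 (1 : R) df d2 ->
  \forall t \near t0,
    df t0 * (t - t0) + (d2 - e) / 2 * (t - t0) ^+ 2 <= f t - f t0.
Proof.
move=> e0 fdf [dfv dfE].
have dfd2 : h^-1 *: (df (h *: 1 + t0) - df t0) @[h --> (0 : R)^'] --> d2.
  by rewrite -dfE; exact: dfv.
have /cvgrPdist_lt /(_ e e0) /nbhs_ballP [r1 /= r1_gt0 r1P] := dfd2.
move: fdf => /nbhs_ballP [r2 /= r2_gt0 r2P].
(* Near [t0] the difference quotients of [df] exceed [c]. Hence f minus the quadratic with slope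
   [df t0] and second derivative [c] has a derivative with the sign of s - t0, and the mean value
   theorem on either side shows that it is minimal at [t0]. *)
pose c := d2 - e.
have slope s : s != t0 -> `|t0 - s| < r1 ->
    0 <= (df s - df t0 - c * (s - t0)) * (s - t0).
  move=> st sr; have st0 : s - t0 != 0 by rewrite subr_eq0.
  have := r1P (s - t0); rewrite /ball /= sub0r opprB => /(_ sr st0).
  rewrite /GRing.scale /= mulr1 subrK ltr_norml => /andP[_].
  set q := _^-1 * _ => qlt.
  have -> : df s - df t0 = q * (s - t0) by rewrite /q mulrC mulVKf.
  rewrite -mulrBl -mulrA -expr2 mulr_ge0 ?sqr_ge0// /c; lra.
pose g := f - (cst (df t0) * id + cst (c / 2) * ((id - cst t0) * (id - cst t0))).
have gd s : `|t0 - s| < r2 -> is_derive s (1 : R) g (df s - df t0 - c * (s - t0)).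
  move=> /r2P fs; apply: is_derive_eq.
  by rewrite /GRing.scale /= !fctE; field.
have gE s : g s - g t0 = f s - f t0 - (df t0 * (s - t0) + c / 2 * (s - t0) ^+ 2).
  by rewrite /g !fctE /=; ring.
apply/nbhs_ballP; exists (Num.min r1 r2) => /=; first by rewrite lt_min r1_gt0.
move=> t; rewrite /ball /= lt_min => /andP[tr1 tr2].
rewrite -subr_ge0 -gE.
have [tt0|tt0|->] := ltgtP t t0; last by rewrite subrr.
- have bd s : t <= s <= t0 -> `|t0 - s| < r2.
    move: tr2; rewrite !ltr_norml => /andP[? ?] /andP[? ?]; apply/andP; split; lra.
  have gc : {within `[t, t0], continuous g}.
    apply: derivable_within_continuous => s; rewrite in_itv /= => /bd sr.
    exact: (@ex_derive _ _ _ _ _ _ _ (gd s sr)).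
  have gd' s : s \in `]t, t0[ -> is_derive s (1 : R) g (df s - df t0 - c * (s - t0)).
    by rewrite in_itv /= => /andP[ts st]; apply: gd; apply: bd; rewrite !ltW.
  have [s /[!in_itv]/= /andP[ts st]] := MVT tt0 gd' gc.
  move=> E; have := slope s; rewrite lt_eqF// => /(_ isT).
  have sr1 : `|t0 - s| < r1.
    by move: tr1; rewrite !ltr_norml => /andP[? ?]; apply/andP; split; lra.
  move=> /(_ sr1); set D := df s - df t0 - _ in E *.
  rewrite nmulr_lge0 ?subr_lt0// => D0.
  by rewrite -opprB E oppr_ge0 mulr_le0_ge0// subr_ge0 ltW.
- have bd s : t0 <= s <= t -> `|t0 - s| < r2.
    move: tr2; rewrite !ltr_norml => /andP[? ?] /andP[? ?]; apply/andP; split; lra.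
  have gc : {within `[t0, t], continuous g}.
    apply: derivable_within_continuous => s; rewrite in_itv /= => /bd sr.
    exact: (@ex_derive _ _ _ _ _ _ _ (gd s sr)).
  have gd' s : s \in `]t0, t[ -> is_derive s (1 : R) g (df s - df t0 - c * (s - t0)).
    by rewrite in_itv /= => /andP[ts st]; apply: gd; apply: bd; rewrite !ltW.
  have [s /[!in_itv]/= /andP[ts st] E] := MVT tt0 gd' gc.
  have := slope s; rewrite gt_eqF// => /(_ isT).
  have sr1 : `|t0 - s| < r1.
    by move: tr1; rewrite !ltr_norml => /andP[? ?]; apply/andP; split; lra.
  move=> /(_ sr1); set D := df s - df t0 - _ in E *.
  rewrite pmulr_lge0 ?subr_gt0// => D0.
  by rewrite E mulr_ge0// subr_ge0 ltW.
Qed.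

(** The function w(x) = g(|x - y|^2) has gradient 2 g' (x - y) and Hessian 4 g'' (x - y)^T (x - y) +
    2 g' I, so the hypothesis on [B] says that the Pucci operator of its Hessian stays strictly
    below |Dw|^gam. At an interior minimum of u - w the supersolution property would contradict
    this, so the minimum over the annulus is on its boundary. *)
Lemma radial_comparison {R : realType} {N : nat} (lam Lam q gam : R)
    (F : 'rV[R]_N -> 'M[R]_N -> R) (u : 'rV[R]_N -> R) (y : 'rV[R]_N)
    (t0 t1 : R) (g dg d2g : R -> R) :
  0 < lam -> lam <= Lam ->
  uniformly_elliptic lam Lam F -> (forall x, F x 0 = 0) ->
  viscosity_supersolution
    (fun x r p X => F x X - (r `^ q + (enorm p) `^ gam)) u ->
  0 < t0 ->
  (forall t, t0 <= t <= t1 ->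
    is_derive t (1 : R) g (dg t) /\ is_derive t (1 : R) dg (d2g t)) ->
  (forall t, t0 < t < t1 -> dg t <= 0 /\
    exists2 B, B < (2 * `|dg t| * Num.sqrt t) `^ gam &
    forall s, lam <= s -> s <= Lam ->
      Lam * (N%:R - 1) * - (2 * dg t) + (- (2 * dg t) - 4 * d2g t * t) * s
        <= B) ->
  forall x, t0 <= sqdist y x <= t1 ->
    exists2 z, sqdist y z = t0 \/ sqdist y z = t1 &
      u z - g (sqdist y z) <= u x - g (sqdist y x).
Proof.
move=> lam0 lamLam Fell F0 [ulsc usup] t0_gt0 gder gstrict x xK.
pose K := [set w | t0 <= sqdist y w <= t1].
have Kcompact : compact K.
  apply: (subclosed_compact _ (sqdist_ball_compact y t1)); last first.
    by move=> w /= /andP[].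
  have /continuous_closedP closedT := sqdist_continuous y.
  have -> : K = (sqdist y @^-1` [set t | t0 <= t]) `&`
      (sqdist y @^-1` [set t | t <= t1]).
    by apply/seteqP; split => w /= => [/andP[]|[? ?]] //; apply/andP.
  by apply: closedI; apply: closedT; [exact: closed_ge|exact: closed_le].
have nearT (P : R -> Prop) w : (\forall t \near sqdist y w, P t) ->
  \forall v \near w, P (sqdist y v) by exact: sqdist_continuous.
have lscK w : K w -> forall e, 0 < e -> \forall v \near w,
    u w - g (sqdist y w) - e < u v - g (sqdist y v).
  move=> Kw e e0; have e20 : 0 < e / 2 by rewrite divr_gt0.
  have gc : {for sqdist y w, continuous g}.
    have [dgw _] := gder _ Kw.
    exact/differentiable_continuous/derivable1_diffP/(@ex_derive _ _ _ _ _ _ _ dgw).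
  have gnear : \forall t \near sqdist y w, `|g (sqdist y w) - g t| < e / 2.
    by move/cvgrPdist_lt : gc => /(_ _ e20).
  near=> v.
  have : `|g (sqdist y w) - g (sqdist y v)| < e / 2.
    by near: v; exact: (nearT (fun t => `|g (sqdist y w) - g t| < e / 2)).
  have : u w - e / 2 < u v by near: v; exact: ulsc.
  rewrite ltr_norml => uv /andP[g1 g2]; lra.
have [z Kz zmin] := compact_lsc_min _ _ _ Kcompact (ex_intro _ x xK) lscK.
exists z; last exact: zmin.
have [//|zt0] := eqVneq (sqdist y z) t0; first by left.
have [//|zt1] := eqVneq (sqdist y z) t1; first by right.
exfalso.
have Iz : t0 < sqdist y z < t1.
  by move/andP: Kz => [? ?]; rewrite !lt_neqAle zt1 eq_sym zt0; apply/andP.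
set t := sqdist y z in zt0 zt1 Iz *.
have [t0t tt1] := andP Iz.
have t_gt0 : 0 < t := lt_trans t0_gt0 t0t.
have Lam0 : 0 < Lam := lt_le_trans lam0 lamLam.
have [dg0 [B Blt Bge]] := gstrict t Iz.
(* A quadratic polynomial in [|x - y|^2] replaces [g] as the globally [C^2]
   test function; lowering its second derivative by [e] makes it touch from
   below, and [e] is paid for by the gap between [B] and [rhs]. *)
set rhs := _ `^ _ in Blt.
pose e := (rhs - B) / (8 * Lam * t).
have e0 : 0 < e by rewrite divr_gt0 ?subr_gt0// !mulr_gt0.
pose phi := radial_quad y t (dg t) (d2g t - e).
have Inear : \forall s \near t, t0 <= s <= t1.
  near=> s; apply/andP; split; apply: ltW; near: s.
    exact: lt_nbhsr.
  exact: lt_nbhsl.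
have phimin : local_min_at (fun w => u w - phi w) z.
  have gnear : \forall s \near t, is_derive s (1 : R) g (dg s).
    by apply: filterS Inear => s /gder[].
  have [_ dgt] := gder t Kz.
  have ty := taylor2_le _ _ _ _ _ e0 gnear dgt.
  rewrite /local_min_at; near=> w.
  have Kw : K w by near: w; exact: (nearT (fun s => t0 <= s <= t1)).
  have tw : dg t * (sqdist y w - t) + (d2g t - e) / 2 * (sqdist y w - t) ^+ 2
      <= g (sqdist y w) - g t.
    by near: w; exact: (nearT (fun s => dg t * (s - t) +
         (d2g t - e) / 2 * (s - t) ^+ 2 <= g s - g t)).
  have := zmin w Kw; rewrite /phi /radial_quad -/t subrr.
  lra.
have := usup z phi (C2_radial_quad _ _ _ _) phimin.
rewrite grad_radial_quad// hessian_radial_quad// enormZ -/(sqdist y z) -/t.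
have -> : `|2 * dg t| = 2 * `|dg t| by rewrite normrM ger0_norm.
rewrite -/rhs; apply/negP; rewrite -ltNge subr_lt0.
apply: (@lt_le_trans _ _ rhs); last by rewrite lerDr powR_ge0.
have Fle := elliptic_le_pucci _ _ _ z _ Fell (F0 z)
  (symmetric_radial (- (2 * dg t)) (4 * (d2g t - e)) (z - y)).
apply: (le_lt_trans Fle).
(* Lowering the second derivative by [e] raises the bound by 4 e t s <= 4 e t Lam, which is half the
   gap between [B] and [rhs]. *)
apply: (@le_lt_trans _ _ (B + 4 * e * t * Lam)).
  apply: pucci_plus_radial_le => //.
    by rewrite oppr_ge0 mulr_ge0_le0.
  rewrite -/(sqdist y z) -/t => s lams sLam.
  have := Bge s lams sLam.
  have et : 0 <= e * t by rewrite mulr_ge0 ?ltW.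
  have := ler_wpM2l et sLam.
  lra.
have -> : 4 * e * t * Lam = (rhs - B) / 2.
  by rewrite /e; field; rewrite !gt_eqF.
by lra.
Unshelve. all: by end_near. Qed.

(** * The profile of the barrier in the logarithmic variable *)

Section Profile.
Context {R : realType}.
Variable p : R.

(* [slope] is [profile + profile'] and [dslope] is the derivative of [slope]. *)
Definition profile (L : R) : R := L `^ (- p) - p * L `^ (- p - 1).
Definition slope (L : R) : R :=
  L `^ (- p) - 2 * p * L `^ (- p - 1) + p * (p + 1) * L `^ (- p - 2).
Definition dslope (L : R) : R :=
  - p * L `^ (- p - 1) + 2 * p * (p + 1) * L `^ (- p - 2)
  - p * (p + 1) * (p + 2) * L `^ (- p - 3).

Lemma is_derive_expR_profile (L : R) : 0 < L ->
  is_derive L (1 : R) (fun s => expR s * profile s) (expR L * slope L).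
Proof.
move=> L0.
have d1 := is_derive1_powR (- p) L0; have d2 := is_derive1_powR (- p - 1) L0.
have -> : (fun s => expR s * profile s) =
    expR * ((@powR R)^~ (- p) - cst p * (@powR R)^~ (- p - 1)) by [].
apply: is_derive_eq.
rewrite /GRing.scale /= !fctE /slope.
have -> : - p - 1 - 1 = - p - 2 by ring.
ring.
Qed.

Lemma is_derive_expR_slope (L : R) : 0 < L ->
  is_derive L (1 : R) (fun s => expR s * slope s)
    (expR L * (slope L + dslope L)).
Proof.
move=> L0.
have d1 := is_derive1_powR (- p) L0; have d2 := is_derive1_powR (- p - 1) L0.
have d3 := is_derive1_powR (- p - 2) L0.
have -> : (fun s => expR s * slope s) =
    expR * ((@powR R)^~ (- p) - cst (2 * p) * (@powR R)^~ (- p - 1)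
     + cst (p * (p + 1)) * (@powR R)^~ (- p - 2)) by [].
apply: is_derive_eq.
rewrite /GRing.scale /= !fctE /slope /dslope.
have -> : - p - 1 - 1 = - p - 2 by ring.
have -> : - p - 2 - 1 = - p - 3 by ring.
ring.
Qed.

Lemma powR_subn L n : 0 < L -> L `^ (- p - n%:R) = L `^ (- p) * L^-1 ^+ n.
Proof.
move=> L0; rewrite powRB; last by rewrite (gt_eqF L0) implybT.
by rewrite powR_mulrn ?ltW// exprVn.
Qed.

Lemma powR_sub1 L : 0 < L -> L `^ (- p - 1) = L `^ (- p) * L^-1.
Proof. by move=> /(powR_subn _ 1); rewrite expr1. Qed.

Lemma profileE L : 0 < L -> profile L = L `^ (- p) * (1 - p * L^-1).
Proof. by move=> L0; rewrite /profile powR_sub1//; ring. Qed.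

Lemma slopeE L : 0 < L -> slope L =
  L `^ (- p) * (1 - 2 * p * L^-1 + p * (p + 1) * L^-1 ^+ 2).
Proof. by move=> L0; rewrite /slope powR_sub1// powR_subn//; ring. Qed.

Hypothesis p0 : 0 < p.

(** This is determinant over trace for the positive definite form a^2 - 2 p a b + p (p + 1) b^2,
    hence a lower bound for its least eigenvalue. [slope_ge] evaluates the form at (1, 1/L). *)
Let c := p / (1 + p + p ^+ 2).

Lemma slope_ge L : 0 < L -> L `^ (- p) * (c * (1 + L^-1 ^+ 2)) <= slope L.
Proof.
move=> L0; rewrite slopeE// ler_pM2l ?powR_gt0// /c.
have q0 : 0 < 1 + p + p ^+ 2 by nra.
rewrite mulrAC ler_pdivrMr// -subr_ge0; set x := L^-1.
have -> : (1 - 2 * p * x + p * (p + 1) * x ^+ 2) * (1 + p + p ^+ 2)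
    - p * (1 + x ^+ 2) = (1 - p * x) ^+ 2 + (p - (1 + p) * (p * x)) ^+ 2.
  by ring.
by rewrite addr_ge0 ?sqr_ge0.
Qed.

Lemma slope_gt0 L : 0 < L -> 0 < slope L.
Proof.
move=> L0; apply: lt_le_trans (slope_ge L L0).
have q0 : 0 < 1 + p + p ^+ 2 by nra.
by rewrite !mulr_gt0 ?powR_gt0 ?invr_gt0// ltr_pwDl// sqr_ge0.
Qed.

(** Both sides are compared with L^(-p-1) (1 + L^-2). The relation p gam = p + 1 turns the factor
    L^(-p) of [slope] into L^(-p-1) under the power [gam], and (1 + L^-2)^gam >= 1 + L^-2 covers
    small L. *)
Lemma dslope_le L gam : 1 < gam -> p * gam = p + 1 -> 0 < L ->
  - dslope L <= p * (p + 1) * (p + 2) / c `^ gam * slope L `^ gam.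
Proof.
move=> g1 pg L0.
have q0 : 0 < 1 + p + p ^+ 2 by nra.
have c0 : 0 < c by rewrite /c divr_gt0.
set x := L^-1; have x0 : 0 < x by rewrite invr_gt0.
have pw : 0 < L `^ (- p) by exact: powR_gt0.
have lower : c `^ gam * (L `^ (- p - 1) * (1 + x ^+ 2)) <= slope L `^ gam.
  have r0 : 0 < c * (1 + x ^+ 2) by rewrite mulr_gt0// ltr_pwDl// sqr_ge0.
  apply: (@le_trans _ _ ((L `^ (- p) * (c * (1 + x ^+ 2))) `^ gam)); last first.
    apply: ge0_ler_powR; last exact: slope_ge.
    + exact: ltW (lt_trans ltr01 g1).
    + by rewrite nnegrE ltW// mulr_gt0.
    + by rewrite nnegrE ltW// slope_gt0.
  rewrite (powRM _ (ltW pw) (ltW r0)).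
  rewrite powRM ?(ltW c0) ?addr_ge0 ?sqr_ge0//.
  rewrite -powRrM mulNr pg opprD mulrCA ler_pM2l ?powR_gt0//.
  rewrite ler_pM2l ?powR_gt0//.
  by apply: le1r_powR; [rewrite lerDl sqr_ge0|exact: ltW].
apply: (@le_trans _ _ (p * (p + 1) * (p + 2) * (L `^ (- p - 1) * (1 + x ^+ 2)))).
  rewrite /dslope powR_sub1// !powR_subn// -/x.
  set w := L `^ (- p) in pw *.
  have -> : - (- p * (w * x) + 2 * p * (p + 1) * (w * x ^+ 2) -
     p * (p + 1) * (p + 2) * (w * x ^+ 3)) =
   (w * x * p) * (1 - 2 * (p + 1) * x + (p + 1) * (p + 2) * x ^+ 2) by ring.
  have -> : p * (p + 1) * (p + 2) * (w * x * (1 + x ^+ 2)) =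
    (w * x * p) * ((p + 1) * (p + 2) + (p + 1) * (p + 2) * x ^+ 2) by ring.
  rewrite ler_pM2l ?mulr_gt0// lerD2r.
  have := mulr_gt0 p0 x0; nra.
have k0 : 0 < p * (p + 1) * (p + 2) by rewrite !mulr_gt0 ?addr_gt0.
rewrite -[leRHS]mulrA ler_pM2l//.
by rewrite ler_pdivlMl ?powR_gt0.
Qed.

End Profile.

(** * The barrier and its strict differential inequality *)

Section Barrier.
Context {R : realType}.
Variables (al p C S : R).
Implicit Types t : R.

(* The barrier is a function of [t = r^2]; with [al = (beta - 2) / 2] the
   blow-up radius [r1] is encoded by [S = 2 * al * ln r1]. *)
Definition logvar (t : R) : R := S - al * ln t.
(** The factor exp(-S) exp(logvar t) is t^(-al) = r^(2 - beta). Written with exponentials, the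
    barrier depends on t through [logvar] alone, and the chain rule gives its derivatives. *)
Definition barrier (t : R) : R :=
  C * expR (- S) * (expR (logvar t) * profile p (logvar t)).
Definition dbarrier (t : R) : R :=
  - (C * al * expR (- S)) * (expR (logvar t) * slope p (logvar t)) * t^-1.
Definition d2barrier (t : R) : R :=
  C * al * expR (- S) * t^-1 ^+ 2 * expR (logvar t) *
  (slope p (logvar t) + al * (slope p (logvar t) + dslope p (logvar t))).

Lemma is_derive_logvar t : 0 < t -> is_derive t (1 : R) logvar (- (al * t^-1)).
Proof.
move=> t0; have dln := is_derive1_ln t0.
have -> : logvar = cst S - al \*: (@ln R) by [].
apply: is_derive_eq; rewrite /GRing.scale /=; ring.
Qed.

Lemma is_derive_barrier t : 0 < t -> 0 < logvar t ->
  is_derive t (1 : R) barrier (dbarrier t).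
Proof.
move=> t0 L0.
have d1 := is_derive1_comp (is_derive_expR_profile p _ L0)
  (is_derive_logvar t t0).
have -> : barrier = (C * expR (- S)) \*:
  ((fun s => expR s * profile p s) \o logvar) by [].
apply: is_derive_eq; rewrite /GRing.scale /= /dbarrier; ring.
Qed.

Lemma is_derive_dbarrier t : 0 < t -> 0 < logvar t ->
  is_derive t (1 : R) dbarrier (d2barrier t).
Proof.
move=> t0 L0; have tn0 : t != 0 by rewrite gt_eqF.
have d1 := is_derive1_comp (is_derive_expR_slope p _ L0)
  (is_derive_logvar t t0).
have dV : is_derive t (1 : R) (fun s : R => s^-1) (- t ^- 2 *: 1).
  exact: (is_deriveV tn0).
have -> : dbarrier = cst (- (C * al * expR (- S))) *
  ((fun s => expR s * slope p s) \o logvar) * (fun s : R => s^-1) by [].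
apply: is_derive_eq; rewrite /GRing.scale /= !fctE /d2barrier -exprVn; ring.
Qed.

Lemma expR_logvar t : 0 < t -> expR (- S) * expR (logvar t) = t `^ (- al).
Proof.
move=> t0; rewrite -expRD /logvar addrA addNr add0r.
by rewrite /powR gt_eqF// mulNr//.
Qed.

Lemma barrierE t : 0 < t ->
  barrier t = C * t `^ (- al) * profile p (logvar t).
Proof. by move=> t0; rewrite -expR_logvar// /barrier; ring. Qed.

Lemma dbarrierE t : 0 < t ->
  dbarrier t = - (C * al * t `^ (- al) * t^-1 * slope p (logvar t)).
Proof. by move=> t0; rewrite -expR_logvar// /dbarrier; ring. Qed.

Lemma d2barrierE t : 0 < t ->
  d2barrier t * t = C * al * t `^ (- al) * t^-1 *
  (slope p (logvar t) + al * (slope p (logvar t) + dslope p (logvar t))).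
Proof.
move=> t0; rewrite -expR_logvar// /d2barrier; field.
by rewrite gt_eqF.
Qed.

End Barrier.

(* The left-hand side of the last inequality bounds [- Tr (A D^2 w)] for the
   barrier [w], where [s] is the Rayleigh quotient of [A] in the radial
   direction and [Lam (N - 1) = lam (2 al + 1)]; its terms without [dslope]
   cancel at [s = lam] and are negative for [s > lam]. *)
Lemma barrier_strict {R : realType} (lam Lam al p gam t0 : R) :
  0 < lam -> lam <= Lam -> 0 < al -> 0 < p -> 1 < gam ->
  p * gam = p + 1 -> gam * (2 * al + 1) <= 2 * al + 2 -> 0 < t0 ->
  exists2 C, 0 < C & forall S t, t0 <= t -> 0 < logvar al S t ->
  dbarrier al p C S t <= 0 /\
  exists2 B, B < (2 * `|dbarrier al p C S t| * Num.sqrt t) `^ gam &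
  forall s, lam <= s -> s <= Lam ->
    lam * (2 * al + 1) * - (2 * dbarrier al p C S t) +
    (- (2 * dbarrier al p C S t) - 4 * d2barrier al p C S t * t) * s <= B.
Proof.
move=> lam0 lamLam al0 p0 gam1 pgam gamal t0_gt0.
have Lam0 : 0 < Lam := lt_le_trans lam0 lamLam.
have [K K0 dslopeK] : exists2 K, 0 < K &
    forall L, 0 < L -> - dslope p L <= K * slope p L `^ gam.
  exists (p * (p + 1) * (p + 2) / (p / (1 + p + p ^+ 2)) `^ gam).
    by rewrite !(mulr_gt0, invr_gt0, powR_gt0, addr_gt0, exprn_gt0).
  by move=> L; exact: dslope_le.
(* With Z = t^(-al-1), (Z sqrt t)^gam = Z t^th. The upper bound on [gam] is exactly th >= 0, which
   allows t^th to be bounded below by t0^th. *)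
pose th := al + 1 - (al + 2^-1) * gam.
have th0 : 0 <= th by rewrite /th; lra.
pose M := 4 * al * Lam * K * t0 `^ (- th).
have M0 : 0 < M by rewrite !mulr_gt0 ?powR_gt0.
have ME : M = 4 * al * Lam * K * t0 `^ (- th) by [].
clearbody M.
have g10 : 0 < gam - 1 by rewrite subr_gt0//.
(* The gradient term is superlinear in the amplitude: this X solves X^gam = 2 M X. The factor 2
   leaves room for strictness. *)
pose X := (2 * M) `^ (gam - 1)^-1.
have X0 : 0 < X by rewrite powR_gt0 ?mulr_gt0//.
have XE : X `^ gam = 2 * M * X.
  have -> : gam = (gam - 1) + 1 by ring.
  rewrite powRD; last by rewrite (gt_eqF X0) implybT.
  rewrite powRr1 ?(ltW X0)// /X -powRrM mulVf ?gt_eqF// powRr1//.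
  by rewrite ltW// mulr_gt0//.
clearbody X.
(* With this C, the derivative of the barrier is -(X / 2) Z P, so its gradient has norm X Z sqrt(t)
   P. *)
exists (X / (2 * al)); first by rewrite divr_gt0 ?mulr_gt0//.
move=> S t t0t L0; have t_gt0 : 0 < t := lt_le_trans t0_gt0 t0t.
rewrite dbarrierE// -[4 * _ * t]mulrA d2barrierE//; set P := slope p _.
have P0 : 0 < P by exact: slope_gt0.
have := dslopeK _ L0; rewrite -/P.
set P' := dslope p _ => P'le.
have -> : X / (2 * al) * al = X / 2 by field; rewrite gt_eqF.
set Z := t `^ (- al) * t^-1.
have Z0 : 0 < Z by rewrite mulr_gt0 ?powR_gt0 ?invr_gt0//.
rewrite -2!(mulrA (X / 2)) -/Z (mulrA (X / 2)).
have ZE : Z = t `^ (- al) * t^-1 by [].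
clearbody Z.
split; first by rewrite oppr_le0 !mulr_ge0 ?divr_ge0 ?ltW.
have grad_ge : 2 * M * X * (Z * t0 `^ th) * P `^ gam <=
    (2 * `|- (X / 2 * Z * P)| * Num.sqrt t) `^ gam.
  rewrite normrN ger0_norm; last by rewrite !mulr_ge0 ?divr_ge0 ?ltW.
  have -> : 2 * (X / 2 * Z * P) * Num.sqrt t = X * (Z * Num.sqrt t) * P.
    by field.
  have Zs0 : 0 < Z * Num.sqrt t by rewrite mulr_gt0 ?sqrtr_gt0//.
  rewrite (powRM _ (ltW (mulr_gt0 X0 Zs0)) (ltW P0)).
  rewrite (powRM _ (ltW X0) (ltW Zs0)) XE.
  rewrite ler_pM2r ?powR_gt0// ler_pM2l ?mulr_gt0//.
  have tE (a b : R) : t `^ (a + b) = t `^ a * t `^ b.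
    by rewrite powRD// (gt_eqF t_gt0) implybT.
  have Zpow : Z = t `^ (- al - 1) by rewrite tE powR_inv1 // ltW.
  have -> : Z * Num.sqrt t = t `^ (- al - 2^-1).
    by rewrite Zpow -powR12_sqrt ?ltW// -tE; congr (_ `^ _); field.
  rewrite -powRrM; have -> : (- al - 2^-1) * gam = (- al - 1) + th.
    by rewrite /th; ring.
  rewrite tE -Zpow ler_pM2l//.
  by apply: ge0_ler_powR => //; rewrite nnegrE ltW.
(* Half of the lower bound in [grad_ge], hence strictly below the gradient term. *)
exists (M * X * (Z * t0 `^ th) * P `^ gam).
  apply: lt_le_trans grad_ge.
  have : 0 < M * X * (Z * t0 `^ th) * P `^ gam by rewrite !mulr_gt0 ?powR_gt0//.
  lra.
move=> s lams sLam.
have -> : M * X * (Z * t0 `^ th) * P `^ gam =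
    X / 2 * Z * (8 * al * Lam * K * P `^ gam).
  rewrite ME powRN; field.
  by rewrite gt_eqF ?powR_gt0//.
have -> : lam * (2 * al + 1) * - (2 * - (X / 2 * Z * P)) +
    (- (2 * - (X / 2 * Z * P)) - 4 * (X / 2 * Z * (P + al * (P + P')))) * s =
    X / 2 * Z * (2 * (2 * al + 1) * P * (lam - s) - 4 * al * P' * s).
  by field.
rewrite ler_pM2l ?mulr_gt0//.
have s0 : 0 < s := lt_le_trans lam0 lams.
have KP0 : 0 <= K * P `^ gam by rewrite mulr_ge0 ?ltW ?powR_gt0//.
have h1 : (2 * al + 1) * P * (lam - s) <= 0.
  by rewrite mulr_ge0_le0 ?subr_le0// mulr_ge0// ltW// addr_gt0 ?mulr_gt0.
have h2 : - P' * s <= K * P `^ gam * Lam.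
  apply: (le_trans (ler_wpM2r (ltW s0) P'le)).
  exact: ler_wpM2l.
have h3 : al * (- P' * s) <= al * (K * P `^ gam * Lam).
  by rewrite ler_wpM2l// ltW.
have h4 : 0 <= al * (K * P `^ gam * Lam).
  exact: mulr_ge0 (ltW al0) (mulr_ge0 KP0 (ltW Lam0)).
lra.
Qed.

(** * Decay, sign and divergence of the barrier *)

Section ProfileBounds.
Context {R : realType}.
Variables (p L : R).
Hypothesis p1 : 1 <= p.

Lemma profile_ge0_le : 1 <= L -> p <= L -> 0 <= profile p L <= L^-1.
Proof.
move=> L1 pL; have L0 : 0 < L := lt_le_trans ltr01 L1.
have pL1 : p * L^-1 <= 1 by rewrite ler_pdivrMr// mul1r.
have pL0 : 0 <= p * L^-1.
  by rewrite mulr_ge0// ?invr_ge0 ?(ltW L0)// (le_trans ler01).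
have w0 : 0 <= L `^ (- p) := powR_ge0 _ _.
have w1 : L `^ (- p) <= L^-1.
  by rewrite powRN lef_pV2 ?posrE ?powR_gt0// le1r_powR.
rewrite profileE//; apply/andP; split; first by rewrite mulr_ge0// subr_ge0.
by apply: le_trans w1; rewrite ler_piMr// gerBl.
Qed.

(** For small L the correction dominates: 1 - p/L <= -1, while L^(-p) >= 1/L. This drives the
    barrier to -oo at the outer radius. *)
Lemma profile_le_opp : 0 < L -> L <= 2^-1 -> profile p L <= - L^-1.
Proof.
move=> L0 L12; rewrite profileE//.
have V2 : 2 <= L^-1 by rewrite -[leLHS]invrK lef_pV2 ?posrE// invr_gt0.
have w1 : L^-1 <= L `^ (- p).
  rewrite -powR_inv1 ?(ltW L0)// !powRN powRr1 ?(ltW L0)//.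
  rewrite lef_pV2 ?posrE ?powR_gt0//.
  have L1 : L <= 1 by lra.
  by rewrite ge1r_powR// L0.
have V0 : 0 < L^-1 by rewrite invr_gt0.
have h : 1 - p * L^-1 <= -1.
  by have := ler_wpM2r (ltW V0) p1; rewrite mul1r; lra.
have := ler_wpM2l (powR_ge0 L (- p)) h; lra.
Qed.

End ProfileBounds.

Lemma barrier_unbounded {R : realType} (al p C S A : R) :
  0 < al -> 1 <= p -> 0 < C ->
  exists t1, [/\ 0 < t1, 0 < logvar al S t1, logvar al S t1 < 1 &
    barrier al p C S t1 <= A].
Proof.
move=> al0 p1 C0.
have a0 : 0 < C * expR (- S) by rewrite mulr_gt0 ?expR_gt0.
have A0 : 0 < `|A| + 1 by rewrite ltr_wpDl.
(* The second entry makes C exp(-S) / L at least |A| + 1; the first gives access to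
   [profile_le_opp]. The point t1 is then the solution of logvar t1 = L. *)
pose L := Num.min 2^-1 (C * expR (- S) / (`|A| + 1)).
have L0 : 0 < L by rewrite lt_min invr_gt0 ltr0n/= divr_gt0.
have L2 : L <= 2^-1 by rewrite ge_min lexx.
have LA : (`|A| + 1) * L <= C * expR (- S).
  by rewrite mulrC -ler_pdivlMr// ge_min lexx orbT.
have lE : logvar al S (expR ((S - L) / al)) = L.
  by rewrite /logvar expRK; field; rewrite gt_eqF.
exists (expR ((S - L) / al)); rewrite lE; split => //; first exact: expR_gt0.
  by apply: le_lt_trans L2 _; rewrite invf_lt1 ?ltr1n.
rewrite /barrier lE.
have e1 : 1 <= expR L by rewrite -expR0 ler_expR ltW.
have hL := profile_le_opp p L p1 L0 L2.
have LV : (`|A| + 1) <= C * expR (- S) * L^-1 by rewrite ler_pdivlMr.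
have V0 : 0 < L^-1 by rewrite invr_gt0.
have ep : expR L * profile p L <= - L^-1.
  have h0 : profile p L <= 0 by apply: (le_trans hL); rewrite oppr_le0 ltW.
  by apply: le_trans hL; have := ler_wnM2r h0 e1; rewrite mul1r.
apply: (le_trans (ler_wpM2l (ltW a0) ep)).
rewrite mulrN lerNl; apply: le_trans LV.
by have := ler_norm (- A); rewrite normrN; lra.
Qed.

Lemma logvar_le {R : realType} (al S s t : R) : 0 < al -> 0 < s -> 0 < t ->
  (logvar al S t <= logvar al S s) = (s <= t).
Proof.
by move=> al0 s0 t0; rewrite /logvar lerD2l lerN2 ler_pM2l// ler_ln ?posrE.
Qed.

Lemma near_sqdist {R : realType} {N : nat} (y : 'rV[R]_N) (P : 'rV[R]_N -> Prop) :
  (\forall w \near y, P w) ->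
  exists2 t0, 0 < t0 & forall w, sqdist y w <= t0 -> P w.
Proof.
(* Library balls are for the sup norm, and each coordinate difference is at most the Euclidean
   distance, here at most r / 2 < r. *)
move=> /nbhs_ballP [r /= r0 rP]; exists ((r / 2) ^+ 2).
  by rewrite exprn_gt0// divr_gt0.
move=> w wr; apply: rP; split => // i j; rewrite ord1 /ball /= ltr_norml.
have := le_trans (sqr_coord_le_sqdist y w j) wr.
by move=> H; apply/andP; split; nra.
Qed.

Lemma barrier_bounds {R : realType} (al p C S t : R) :
  1 <= p -> 0 < C -> 0 < t -> 1 <= logvar al S t -> p <= logvar al S t ->
  0 <= barrier al p C S t <= C * t `^ (- al) / logvar al S t.
Proof.
move=> p1 C0 t0 L1 pL; rewrite barrierE//.
have a0 : 0 <= C * t `^ (- al) by rewrite mulr_ge0 ?powR_ge0 ?ltW.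
have /andP[h0 h1] := profile_ge0_le p _ p1 L1 pL.
by rewrite mulr_ge0//= ler_wpM2l.
Qed.

(** * Passage to the limit and the Liouville property *)

Lemma supersolution_ge {R : realType} {N : nat} (lam Lam al p q gam : R)
    (F : 'rV[R]_N -> 'M[R]_N -> R) (u : 'rV[R]_N -> R) :
  0 < lam -> lam <= Lam -> 0 < al -> Lam * (N%:R - 1) = lam * (2 * al + 1) ->
  1 <= p -> 1 < gam -> p * gam = p + 1 -> gam * (2 * al + 1) <= 2 * al + 2 ->
  uniformly_elliptic lam Lam F -> (forall x, F x 0 = 0) ->
  (forall x, 0 <= u x) ->
  viscosity_supersolution
    (fun x r p X => F x X - (r `^ q + (enorm p) `^ gam)) u ->
  forall x y, u y <= u x.
Proof.
move=> lam0 lamLam al0 LamE p1 gam1 pgam gamal Fell F0 u0 usuper x y.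
have p0 : 0 < p := lt_le_trans ltr01 p1.
apply/ler_addgt0Pr => e e0; rewrite -lerBlDr.
set m := u y - e.
have [ulsc _] := usuper.
have [t0 t0_gt0 um] := near_sqdist _ _ (ulsc y e e0).
have [xt0|t0x] := leP (sqdist y x) t0; first exact/ltW/um.
set t := sqdist y x in t0x *; have t_gt0 : 0 < t := lt_trans t0_gt0 t0x.
have [C C0 strict] :=
  barrier_strict _ _ _ _ _ _ lam0 lamLam al0 p0 gam1 pgam gamal t0_gt0.
apply/ler_addgt0Pr => d d0.
have W0 : 0 < C * t0 `^ (- al) by rewrite mulr_gt0 ?powR_gt0.
(* The terms 1 + p make [barrier_bounds] applicable, and the last term makes the barrier at most [d]
   on the inner sphere. [S] is tuned so that [logvar] equals L at x; it is larger at t0, since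
   [logvar] decreases. Small [d] thus corresponds to a large blow-up radius. *)
pose L := 1 + p + C * t0 `^ (- al) / d.
have Wd : 0 < C * t0 `^ (- al) / d by rewrite divr_gt0.
pose S := al * ln t + L.
have LE : logvar al S t = L by rewrite /logvar /S; ring.
have L0 : L <= logvar al S t0 by rewrite -LE logvar_le// ltW.
have L0_gt0 : 0 < logvar al S t0 by apply: lt_le_trans L0; rewrite /L; lra.
have [t1 [t1_gt0 L1_gt0 L1_lt1 gt1]] :=
  barrier_unbounded al p C S (- `|m|) al0 p1 C0.
have /andP[gt0 _] : 0 <= barrier al p C S t <= C * t `^ (- al) / logvar al S t.
  by apply: barrier_bounds => //; rewrite LE /L; lra.
have /andP[g0 g0le] : 0 <= barrier al p C S t0
    <= C * t0 `^ (- al) / logvar al S t0.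
  by apply: barrier_bounds => //; apply: (le_trans _ L0); rewrite /L; lra.
have g0d : barrier al p C S t0 <= d.
  apply: (le_trans g0le); rewrite ler_pdivrMr// [leRHS]mulrC -ler_pdivrMr//.
  by apply: (le_trans _ L0); rewrite /L; lra.
have tt1 : t <= t1.
  by rewrite -(logvar_le al S)// LE (le_trans (ltW L1_lt1))// /L; lra.
have Lpos s : t0 <= s <= t1 -> 0 < s /\ 0 < logvar al S s.
  move=> /andP[t0s st1]; have s0 : 0 < s := lt_le_trans t0_gt0 t0s.
  by split => //; apply: lt_le_trans L1_gt0 _; rewrite logvar_le.
have [|||z zK uz] := @radial_comparison R N lam Lam q gam F u y t0 t1
  (barrier al p C S) (dbarrier al p C S) (d2barrier al p C S)
  lam0 lamLam Fell F0 usuper t0_gt0 _ _ x.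
- move=> s /Lpos[s0 sL]; split; first exact: is_derive_barrier.
  exact: is_derive_dbarrier.
- move=> s /andP[t0s st1].
  have [|s0 sL] := Lpos s; first by rewrite !ltW.
  by rewrite LamE; exact: strict (ltW t0s) sL.
- by rewrite -/t tt1 ltW.
(* On the inner sphere u z > m and the barrier is at most [d]; on the outer one u z >= 0 and the
   barrier is at most -|m|. The barrier being nonnegative at x, both give m <= u x + d. *)
case: zK => zE; rewrite zE -/t in uz.
- have : m < u z by apply: um; rewrite zE.
  by lra.
- have := u0 z; have := ler_norm m; lra.
Qed.

Theorem theorem2p1 (R : realType) (N : nat) (lam Lam q gam : R)
  (F : 'rV[R]_N -> 'M[R]_N -> R) (u : 'rV[R]_N -> R) :
  (1 <= N)%N ->
  0 < lam -> lam <= Lam ->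
  2 < Lam / lam * (N%:R - 1) + 1 ->
  continuous_on_sym F ->
  uniformly_elliptic lam Lam F ->
  (forall x, F x 0 = 0) ->
  (let beta := Lam / lam * (N%:R - 1) + 1 in
   beta / (beta - 2) < q /\ 1 < gam /\ gam <= beta / (beta - 1)) ->
  (forall x, 0 <= u x) ->
  viscosity_supersolution
    (fun x r p X => F x X - (r `^ q + (enorm p) `^ gam)) u ->
  exists c : R, forall x, u x = c.
Proof.
move=> _ lam0 lamLam beta2 _ Fell F0 [_ [gam1 gamle]] u0 usuper.
set beta := Lam / lam * (N%:R - 1) + 1 in beta2 gamle.
have gam10 : 0 < gam - 1 by lra.
have gam_beta : gam * (beta - 1) <= beta.
  by move: gamle; rewrite ler_pdivlMr//; lra.
(* Equivalently gam <= 2: indeed (gam - 1) (beta - 1) <= 1 with beta - 1 > 1. *)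
have p1 : 1 <= (gam - 1)^-1.
  rewrite -[leLHS]invr1 lef_pV2 ?posrE//.
  nra.
(* With al = (beta - 2) / 2, the factor 2 al + 1 is beta - 1 = (Lam / lam) (N - 1). *)
have LamE : Lam * (N%:R - 1) = lam * (2 * ((beta - 2) / 2) + 1).
  by rewrite /beta; field; rewrite gt_eqF.
have al0 : 0 < (beta - 2) / 2 by lra.
have pgam : (gam - 1)^-1 * gam = (gam - 1)^-1 + 1.
  by field; rewrite gt_eqF.
have gamal : gam * (2 * ((beta - 2) / 2) + 1) <= 2 * ((beta - 2) / 2) + 2.
  by lra.
have uge := supersolution_ge _ _ _ _ _ _ _ _ lam0 lamLam al0 LamE p1 gam1 pgam
  gamal Fell F0 u0 usuper.
by exists (u 0) => x; apply/le_anti; rewrite !uge.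
Qed.
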